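(* Let $|q|<1$ and define integers $a_n,b_n$ by $$\sum_{n=0}^{\infty}a_nq^n=(-q,-q^4;q^5)_\infty(q,q^9;q^{10})_\infty^3,\qquad \sum_{n=0}^{\infty}b_nq^n=(-q^2,-q^3;q^5)_\infty(q^3,q^7;q^{10})_\infty^3,$$ with the convention $a_n=0$ for $n<0$. Then $$\sum_{n=0}^{\infty}b_{5n}q^n-\sum_{n=1}^{\infty}a_{5n-2}q^n=\frac{f_1^4}{f_2^4},$$ and for all $n\ge 0$, $$b_{5n+1}=a_{5n-1},\quad b_{5n+2}=a_{5n},\quad b_{5n+3}=a_{5n+1},\quad b_{5n+4}=a_{5n+2}.$$
   Context: For complex $a$ and $|q|<1$, $(a;q)_\infty=\prod_{k=0}^{\infty}(1-aq^k)$ and $(a_1,\dots,a_m;q)_\infty=(a_1;q)_\infty\cdots(a_m;q)_\infty$. For a positive integer $k$, $f_k:=(q^k;q^k)_\infty$. *)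

(* Defs.v *)
From HB Require Import structures.
From mathcomp Require Import all_boot all_order all_algebra.
From mathcomp Require Import complex.
From mathcomp Require Import all_classical all_reals all_analysis.

Set Implicit Arguments.
Unset Strict Implicit.
Unset Printing Implicit Defensive.

Import Order.TTheory GRing.Theory Num.Theory.
Import numFieldNormedType.Exports.

Local Open Scope classical_set_scope.
Local Open Scope ring_scope.
Local Open Scope complex_scope.

(* R[i] seen as a numFieldType, so that it carries the topology of its modulus
   given by numFieldNormedType. *)
Definition Cplx (R : realType) : numFieldType := R[i].

(* For K = Cplx R and `|q| < 1 this limit exists for every z. *)
Definition qpoch (K : numFieldType) (z q : K) : K :=
  limn (fun n : nat => \prod_(0 <= k < n) (1 - z * q ^+ k)).

Definition qpochs (K : numFieldType) (zs : seq K) (q : K) : K :=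
  \prod_(z <- zs) qpoch z q.

Definition eulerf (K : numFieldType) (k : nat) (q : K) : K :=
  qpoch (q ^+ k) (q ^+ k).

(* Main.v *)
Require Import Defs.
From HB Require Import structures.
From mathcomp Require Import all_boot all_order all_algebra.
From mathcomp Require Import complex.
From mathcomp Require Import all_classical all_reals all_analysis.
From mathcomp Require Import zify ring lra.

Set Implicit Arguments.
Unset Strict Implicit.
Unset Printing Implicit Defensive.

Import Order.TTheory GRing.Theory Num.Theory.
Import numFieldNormedType.Exports.

Local Open Scope classical_set_scope.
Local Open Scope ring_scope.
Local Open Scope complex_scope.

(** Put [T_i = (q^i, q^(10-i); q^10)].  Since [(-q, -q^4; q^5) = T_2 / (T_1 T_4)]
and [(-q^2, -q^3; q^5) = T_4 / (T_2 T_3)], all the assertions say that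
[sum_n (b_n - a_(n-2)) q^n] is the power series [f_5^4 / f_10^4] in [q^5], that is
[T_4^2 T_3^2 - q^2 T_1^2 T_2^2 = T_5^2 T_2 T_4].  The coefficients outside the
multiples of 5 then vanish because the sum is invariant under [q -> zeta q] with
[zeta^5 = 1].

The identity between the [T_i] is an instance of Weierstrass' addition formula for
[theta(z) = (z, p/z; p)].  The triple product writes [theta] as a bilateral series,
and splitting the double series for [theta(x y) theta(x / y)] by the parity of the
sum of its indices gives [x] times the determinant of two vectors depending on [x]
and [y] alone, so that the addition formula is a Pluecker relation.  To have only
finite sums this is done for the finite products in a ring where the nome [p] is
nilpotent, hence modulo [p^n] for polynomials in [p].  The coefficients of these
polynomials are uniformly bounded in a weighted l1 norm, on a circle larger than
that of the actual nome, so that a remainder divisible by [p^n] tends to zero. *)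

Section QBinomial.
Variables (A : comNzRingType) (p : A).

Fixpoint qbin (n k : nat) : A :=
  match n, k with
  | _, 0 => 1
  | 0, _.+1 => 0
  | n'.+1, k'.+1 => p ^+ k * qbin n' k + qbin n' k'
  end.

Lemma qbin0 n : qbin n 0 = 1.
Proof. by case: n. Qed.

Lemma qbin_small n k : (n < k)%N -> qbin n k = 0.
Proof.
elim: n k => [|n IHn] [|k] //= nk.
by rewrite !IHn ?mulr0 ?addr0 //; lia.
Qed.

Lemma qbinomial_thm x n :
  \prod_(k < n) (1 + x * p ^+ k) =
  \sum_(j < n.+1) qbin n j * p ^+ 'C(j, 2) * x ^+ j.
Proof.
elim: n x => [|n IHn] x.
  by rewrite big_ord0 big_ord1 /= !expr0 !mulr1.
rewrite big_ord_recl expr0 mulr1.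
under eq_bigr => i _ do rewrite exprS mulrA.
rewrite IHn mulrDl mul1r mulr_sumr.
rewrite big_ord_recl [RHS]big_ord_recl /= !qbin0 -addrA; congr (_ + _).
under [RHS]eq_bigr => i _ do rewrite /bump /= add1n !mulrDl.
rewrite big_split /=; congr (_ + _).
  rewrite [RHS]big_ord_recr /= qbin_small // mulr0 !mul0r addr0.
  by apply: eq_bigr => i _; rewrite exprMn /bump /= add1n; ring.
apply: eq_bigr => i _.
by rewrite binS bin1 exprD exprMn !exprS; ring.
Qed.

Definition qffact (n k : nat) : A := \prod_(i < k) (1 - p ^+ (n - i)).

Definition qfact (n : nat) : A := qffact n n.

Lemma qffactD n k l : qffact n (k + l) = qffact n k * qffact (n - k) l.
Proof.
rewrite /qffact big_split_ord; congr (_ * _).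
by apply: eq_bigr => i _; rewrite subnDA.
Qed.

Lemma qffact_mul_id n k y :
  (k <= n)%N -> p ^+ (n - k).+1 * y = 0 -> qffact n k * y = y.
Proof.
move=> kn py0; apply: (big_ind (fun f => f * y = y)) => [|f g fy gy|i _].
- by rewrite mul1r.
- by rewrite -mulrA gy.
have -> : (n - i = (k - i.+1) + (n - k).+1)%N by have := ltn_ord i; lia.
by rewrite mulrBl exprD -mulrA py0 mulr0 mul1r subr0.
Qed.

Lemma qbin_qfact n k : qbin n k * qfact k = qffact n k.
Proof.
have qffactS m l : qffact m.+1 l.+1 = (1 - p ^+ m.+1) * qffact m l.
  by rewrite /qffact big_ord_recl.
elim: n k => [|n IHn] [|k]; try by rewrite /qfact /qffact !big_ord0 mulr1.
  by rewrite mul0r [RHS]big_ord_recl subrr mul0r.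
rewrite /= mulrDl -mulrA IHn [qfact _]qffactS mulrCA -/(qfact k) IHn qffactS.
rewrite [qffact n _]big_ord_recr /= -/(qffact n k).
have [kn|nk] := leqP k n; last by rewrite /qffact (bigD1 (Ordinal nk)) //= subnn; ring.
have -> : p ^+ n.+1 = p ^+ k.+1 * p ^+ (n - k) by rewrite -exprD; congr (_ ^+ _); lia.
by ring.
Qed.

Lemma qfact_qbin_mul_id n k y : (k <= n)%N ->
  p ^+ k.+1 * y = 0 -> p ^+ (n - k).+1 * y = 0 -> qfact n * qbin n k * y = y.
Proof.
move=> kn pk pnk.
have -> : qfact n = qffact n (n - k) * qfact k.
  by rewrite /qfact -{2}(subnK kn) qffactD subKn.
rewrite -[_ * qbin n k]mulrA [qfact k * _]mulrC qbin_qfact -mulrA.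
by rewrite (qffact_mul_id kn pnk) qffact_mul_id ?leq_subr // subKn.
Qed.

End QBinomial.

Definition bin2z (j : int) : nat := `|j * (j - 1)|./2.

Lemma bin2zE j : (bin2z j)%:Z *+ 2 = j * (j - 1).
Proof.
rewrite /bin2z; have j0 : 0 <= j * (j - 1) by have [|] := leP 1 j; nia.
have [k [jE|jE]] : exists k : int, j = k *+ 2 \/ j = k *+ 2 + 1.
  by exists (j %/ 2)%Z; lia.
- have {}jE : j * (j - 1) = (k * (j - 1)) *+ 2 by rewrite {1}jE; lia.
  by lia.
have {}jE : j * (j - 1) = (j * k) *+ 2 by rewrite {2}jE; lia.
by lia.
Qed.

Lemma bin2z_nat n : bin2z n%:Z = 'C(n, 2).
Proof. by have := bin2zE n%:Z; have := mul_bin_diag n 1; rewrite bin1; nia. Qed.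

Lemma absz_le_bin2z j : (`|j| <= (bin2z j).+1)%N.
Proof.
have := bin2zE j; suff : `|j| *+ 2 <= j * (j - 1) + 2 by lia.
have [j2|j2] := leP 2 j; first by nia.
by have [|] := leP 0 j; nia.
Qed.

Definition theta_prod (A : comUnitRingType) (p : A) (n : nat) (z : A) : A :=
  (\prod_(k < n) (1 - z * p ^+ k)) * (\prod_(k < n) (1 - z^-1 * p ^+ k.+1)).

Definition weierstrass_defect (A : comUnitRingType) (th : A -> A) (x y u v : A) : A :=
  th (x * y) * th (x / y) * (th (u * v) * th (u / v))
  - th (x * v) * th (x / v) * (th (u * y) * th (u / y))
  - u / y * (th (x * u) * th (x / u) * (th (y * v) * th (y / v))).

Section ThetaTerms.
Variables (A : comUnitRingType) (p : A).

Definition theta_term (z : A) (j : int) : A := (- z) ^ j * p ^+ bin2z j.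

Lemma finite_jacobi_triple_product z n m : z \is a GRing.unit ->
  (\prod_(k < n) (1 - z * p ^+ k)) * (\prod_(k < m) (1 - z^-1 * p ^+ k.+1)) =
  \sum_(i < (n + m).+1) qbin p (n + m) i * theta_term z (i%:Z - m%:Z).
Proof.
move=> zU; elim: m => [|m IHm].
  rewrite big_ord0 mulr1 addn0; under eq_bigr do rewrite -mulNr.
  rewrite qbinomial_thm; apply: eq_bigr => i _.
  by rewrite /theta_term subr0 bin2z_nat -exprnP; ring.
have theta_term_shift i : - (z^-1 * p ^+ m.+1) * theta_term z (i%:Z - m%:Z) =
    p ^+ i * theta_term z (i%:Z - m.+1%:Z).
  have -> : i%:Z - m%:Z = (i%:Z - m.+1%:Z) + 1 by lia.
  set j := i%:Z - _; rewrite /theta_term exprzDr ?unitrN // expr1z.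
  rewrite [RHS]mulrCA -exprD.
  have -> : (i + bin2z j = m.+1 + bin2z (j + 1))%N.
    by have := bin2zE j; have := bin2zE (j + 1); rewrite /j; nia.
  rewrite exprD; transitivity ((z^-1 * z) * ((- z) ^ j * (p ^+ m.+1 * p ^+ bin2z (j + 1)))).
    by ring.
  by rewrite mulVr // mul1r.
rewrite big_ord_recr /= mulrA IHm mulrDr mulr1 addnS addrC mulrC mulr_sumr.
rewrite [RHS]big_ord_recl qbin0 mul1r.
under [in RHS]eq_bigr => i _ do rewrite lift0 /= mulrDl.
rewrite big_split /= addrA; congr (_ + _); last first.
  by apply: eq_bigr => i _; congr (_ * theta_term z _); lia.
transitivity (\sum_(i < (n + m).+2) p ^+ i * qbin p (n + m) i * theta_term z (i%:Z - m.+1%:Z)).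
  rewrite [RHS]big_ord_recr /= qbin_small // mulr0 mul0r addr0.
  by apply: eq_bigr => i _; rewrite mulrCA theta_term_shift; ring.
by rewrite big_ord_recl /= qbin0 expr0 !mul1r.
Qed.

Lemma theta_termM x y j k : x \is a GRing.unit -> y \is a GRing.unit ->
  theta_term (x * y) j * theta_term (x / y) k =
  (-1) ^ (j + k) * x ^ (j + k) * (y ^ (j - k) * p ^+ (bin2z j + bin2z k)).
Proof.
move=> xU yU; have exprMz (u v : A) i : u \is a GRing.unit -> v \is a GRing.unit ->
    (u * v) ^ i = u ^ i * v ^ i by move=> uU vU; exact: exprMz_comm (mulrC u v).
rewrite /theta_term -!mulNr -[- x]mulN1r.
rewrite !exprMz ?unitrV ?unitrM ?unitrN1 // exprz_inv !exprzDr ?unitrN1 // exprD.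
by rewrite -!mulrA; ring.
Qed.

Lemma exprN1z_double (j : int) : (-1) ^ (2 * j) = 1 :> A.
Proof. by rewrite -exprz_exp -exprnP sqrrN expr1n exp1rz. Qed.

Lemma theta_termM_even x y s d : x \is a GRing.unit -> y \is a GRing.unit ->
  theta_term (x * y) (s + d) * theta_term (x / y) (s - d) =
  x * (x ^ (2 * s - 1) * p ^+ (2 * bin2z s) * (y ^ (2 * d) * p ^+ `|d * d|)).
Proof.
move=> xU yU; rewrite theta_termM //.
have -> : (bin2z (s + d) + bin2z (s - d) = 2 * bin2z s + `|(d * d)%R|)%N.
  by have := bin2zE (s + d); have := bin2zE (s - d); have := bin2zE s; nia.
have -> : s + d + (s - d) = 2 * s by lia.
have -> : s + d - (s - d) = 2 * d by lia.
have -> : x ^ (2 * s) = x * x ^ (2 * s - 1).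
  by rewrite -[X in _ = X * _]expr1z -exprzDr //; congr (_ ^ _); lia.
by rewrite exprN1z_double exprD; ring.
Qed.

Lemma theta_termM_odd x y s d : x \is a GRing.unit -> y \is a GRing.unit ->
  theta_term (x * y) (s + d) * theta_term (x / y) (s - d + 1) =
  - x * (x ^ (2 * s) * p ^+ `|s * s| * (y ^ (2 * d - 1) * p ^+ (2 * bin2z d))).
Proof.
move=> xU yU; rewrite theta_termM //.
have -> : (bin2z (s + d) + bin2z (s - d + 1) = `|(s * s)%R| + 2 * bin2z d)%N.
  by have := bin2zE (s + d); have := bin2zE (s - d + 1); have := bin2zE d; nia.
have -> : s + d + (s - d + 1) = 1 + 2 * s by lia.
have -> : s + d - (s - d + 1) = 2 * d - 1 by lia.
rewrite ![_ ^ (1 + _)]exprzDr ?unitrN1 // !expr1z exprN1z_double exprD.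
by ring.
Qed.

End ThetaTerms.

Lemma finite_support_fsbigID (V : nmodType) (I : choiceType) (B : set I) (F : I -> V) :
  finite_set (F @^-1` [set~ 0]) ->
  \sum_(i \in [set: I]) F i = \sum_(i \in B) F i + \sum_(i \in ~` B) F i.
Proof.
move=> suppF; rewrite fsbig_supp setTI (fsbigID B) //.
by rewrite setIC -fsbig_supp setIC -fsbig_supp.
Qed.

Lemma finite_support_fsbigM (A : nzRingType) (I J : choiceType) (F : I -> A) (G : J -> A) :
  finite_set (F @^-1` [set~ 0]) -> finite_set (G @^-1` [set~ 0]) ->
  (\sum_(i \in [set: I]) F i) * (\sum_(j \in [set: J]) G j) =
  \sum_(q \in [set: I * J]) F q.1 * G q.2.
Proof.
move=> suppF suppG; rewrite fsbig_supp [X in _ * X]fsbig_supp !setTI.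
rewrite fsbig_finite // [X in _ * X]fsbig_finite // big_distrlr /=.
under eq_bigr do rewrite -fsbig_finite //.
rewrite -fsbig_finite // pair_fsbig //=.
apply: fsbig_widen => // -[i j] [_ /= /not_andP[] /contrapT ->].
- by rewrite mul0r.
- by rewrite mulr0.
Qed.

Lemma finite_supportM (A : nzRingType) (I J : choiceType) (F : I -> A) (G : J -> A) :
  finite_set (F @^-1` [set~ 0]) -> finite_set (G @^-1` [set~ 0]) ->
  finite_set ((fun q : I * J => F q.1 * G q.2) @^-1` [set~ 0]).
Proof.
move=> suppF suppG; apply: sub_finite_set (finite_setX suppF suppG) => -[i j] /= FG0.
by split=> [Fi0|Gj0]; apply: FG0; rewrite ?Fi0 ?Gj0 ?mul0r ?mulr0.
Qed.

Section NilpotentNome.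
Variables (A : comUnitRingType) (p : A) (n : nat).
Hypothesis pn0 : p ^+ n = 0.

Lemma expr_nilp m : (n <= m)%N -> p ^+ m = 0.
Proof. by move=> /subnK <-; rewrite exprD pn0 mulr0. Qed.

Lemma nilp_finite_support (u : int -> A) (e : int -> nat) :
  (forall j, `|j| <= (e j).+1)%N -> finite_set ((fun j => u j * p ^+ e j) @^-1` [set~ 0]).
Proof.
move=> je; apply: (@sub_finite_set _ _ ((fun i : nat => i%:Z - n%:Z) @` `I_(2 * n).+1)).
  move=> j /= uj0; have ejn : (e j < n)%N.
    by rewrite ltnNge; apply/negP => /expr_nilp pe; apply: uj0; rewrite pe mulr0.
  by exists (absz (j + n%:Z)) => /=; have := je j; lia.
exact: finite_image (finite_II _).
Qed.

Definition theta_series (z : A) : A := \sum_(j \in [set: int]) theta_term p z j.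

(* Jacobi's theta functions [theta_2] and [theta_3] of nome [p], up to a power [p ^ (1/4)]. *)
Definition theta2_series (z : A) : A :=
  \sum_(j \in [set: int]) z ^ (2 * j - 1) * p ^+ (2 * bin2z j).

Definition theta3_series (z : A) : A :=
  \sum_(j \in [set: int]) z ^ (2 * j) * p ^+ `|j * j|.

Lemma theta_term_finite_support z :
  finite_set (theta_term p z @^-1` [set~ 0]).
Proof. by apply: nilp_finite_support; exact: absz_le_bin2z. Qed.

Lemma jacobi_triple_product z : z \is a GRing.unit ->
  qfact p (2 * n) * theta_prod p n z = theta_series z.
Proof.
move=> zU; rewrite /theta_prod finite_jacobi_triple_product // addnn -mul2n mulr_sumr.
transitivity (\sum_(i < (2 * n).+1) theta_term p z (i%:Z - n%:Z)).
  apply: eq_bigr => i _; have ltin := ltn_ord i; rewrite mulrA.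
  have vanish m : (n <= m + bin2z (i%:Z - n%:Z))%N -> p ^+ m * theta_term p z (i%:Z - n%:Z) = 0.
    by move=> nm; rewrite /theta_term mulrCA -exprD expr_nilp ?mulr0.
  have le_bin2z := absz_le_bin2z (i%:Z - n%:Z).
  by rewrite qfact_qbin_mul_id //; apply: vanish; lia.
transitivity (\sum_(i \in `I_(2 * n).+1) theta_term p z (i%:Z - n%:Z)).
  exact: (fsbig_ord _ _ (fun i : nat => theta_term p z (i%:Z - n%:Z))).
rewrite -(@fsbig_image _ _ _ _ _ _ (fun i : nat => i%:Z - n%:Z)); last first.
  by move=> i j _ _; lia.
apply: fsbig_widen => // j [_ /= out].
rewrite /theta_term expr_nilp ?mulr0 //.
have [jn|nj] := leP (absz j) n; last by have := absz_le_bin2z j; lia.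
by case: out; exists (absz (j + n%:Z)) => /=; lia.
Qed.

Lemma theta2_term_finite_support z :
  finite_set ((fun j : int => z ^ (2 * j - 1) * p ^+ (2 * bin2z j)) @^-1` [set~ 0]).
Proof. by apply: nilp_finite_support => j; have := absz_le_bin2z j; lia. Qed.

Lemma theta3_term_finite_support z :
  finite_set ((fun j : int => z ^ (2 * j) * p ^+ `|j * j|) @^-1` [set~ 0]).
Proof. by apply: nilp_finite_support => j; nia. Qed.

(* [(s, d) |-> (s + d, s - d)] and [(s, d) |-> (s + d, s - d + 1)] enumerate the
   pairs of exponents of even and of odd sum. *)
Lemma theta_seriesM x y : x \is a GRing.unit -> y \is a GRing.unit ->
  theta_series (x * y) * theta_series (x / y) =
  x * (theta2_series x * theta3_series y - theta3_series x * theta2_series y).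
Proof.
move=> xU yU.
pose even_sum := [set q : int * int | (2 %| q.1 + q.2)%Z].
have even_bij : set_bij [set: int * int] even_sum (fun q => (q.1 + q.2, q.1 - q.2)).
  split=> [[s d] _|[s d] [s' d'] _ _ [] ? ?|[j k]]; rewrite /even_sum /=.
  - by lia.
  - by congr (_, _); lia.
  - by move=> jk; exists ((j + k) %/ 2, (j - k) %/ 2)%Z => //=; congr (_, _); lia.
have odd_bij : set_bij [set: int * int] (~` even_sum) (fun q => (q.1 + q.2, q.1 - q.2 + 1)).
  split=> [[s d] _|[s d] [s' d'] _ _ [] ? ?|[j k]]; rewrite /even_sum /=.
  - by lia.
  - by congr (_, _); lia.
  - by move=> jk; exists ((j + k) %/ 2, (j - k + 1) %/ 2)%Z => //=; congr (_, _); lia.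
have supp := theta_term_finite_support.
have supp2 := theta2_term_finite_support; have supp3 := theta3_term_finite_support.
rewrite /theta_series /theta2_series /theta3_series.
rewrite (finite_support_fsbigM (supp _) (supp _)).
rewrite (finite_support_fsbigM (supp2 _) (supp3 _)) (finite_support_fsbigM (supp3 _) (supp2 _)).
rewrite (finite_support_fsbigID even_sum (finite_supportM (supp _) (supp _))).
rewrite (reindex_fsbig _ _ _ _ even_bij) (reindex_fsbig _ _ _ _ odd_bij) /=.
rewrite mulrBr -mulNr !full_fsbig_distrr ?setTI.
congr (_ + _); apply: eq_fsbigr => -[s d] _ /=.
- exact: theta_termM_even.
- exact: theta_termM_odd.
- exact: finite_supportM (supp3 _) (supp2 _).
- exact: finite_supportM (supp2 _) (supp3 _).
Qed.

Lemma weierstrass_theta_series x y u v :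
  x \is a GRing.unit -> y \is a GRing.unit -> u \is a GRing.unit -> v \is a GRing.unit ->
  weierstrass_defect theta_series x y u v = 0.
Proof.
move=> xU yU uU vU; rewrite /weierstrass_defect.
rewrite (theta_seriesM xU yU) (theta_seriesM uU vU) (theta_seriesM xU vU) (theta_seriesM uU yU).
rewrite (theta_seriesM xU uU) (theta_seriesM yU vU).
have -> (a b : A) : u / y * (x * a * (y * b)) = x * u * (a * b) * (y^-1 * y) by ring.
by rewrite mulVr //; ring.
Qed.

Lemma qfact_unit m : qfact p m \is a GRing.unit.
Proof.
apply: rpred_prod => i _; apply/unitrPr; exists (\sum_(k < n) (p ^+ (m - i)) ^+ k).
apply: oppr_inj; rewrite -mulNr opprB -subrX1 -exprM expr_nilp ?sub0r //.
by rewrite leq_pmull // subn_gt0.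
Qed.

Lemma weierstrass_theta_prod x y u v :
  x \is a GRing.unit -> y \is a GRing.unit -> u \is a GRing.unit -> v \is a GRing.unit ->
  weierstrass_defect (theta_prod p n) x y u v = 0.
Proof.
move=> xU yU uU vU; apply: (mulrI (unitrX 4 (qfact_unit (2 * n)))).
rewrite mulr0 -(weierstrass_theta_series xU yU uU vU) /weierstrass_defect.
by rewrite -!jacobi_triple_product ?unitrM ?unitrV ?xU ?yU ?uU ?vU //; ring.
Qed.

End NilpotentNome.

Section RingMorphisms.
Variables (A B : comUnitRingType) (phi : {rmorphism A -> B}).

Lemma rmorph_theta_prod p n z : z \is a GRing.unit ->
  phi (theta_prod p n z) = theta_prod (phi p) n (phi z).
Proof.
move=> zU; rewrite rmorphM !rmorph_prod; congr (_ * _); apply: eq_bigr => k _.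
- by rewrite rmorphB rmorphM rmorphXn rmorph1.
- by rewrite rmorphB rmorphM rmorphXn rmorph1 rmorphV.
Qed.

Lemma rmorph_weierstrass_defect (th : A -> A) (th' : B -> B) x y u v :
  (forall z, z \is a GRing.unit -> phi (th z) = th' (phi z)) ->
  x \is a GRing.unit -> y \is a GRing.unit -> u \is a GRing.unit -> v \is a GRing.unit ->
  phi (weierstrass_defect th x y u v) =
  weierstrass_defect th' (phi x) (phi y) (phi u) (phi v).
Proof.
move=> phi_th xU yU uU vU; rewrite /weierstrass_defect !(rmorphB, rmorphM).
by rewrite !phi_th ?unitrM ?unitrV ?xU ?yU ?uU ?vU // !rmorphM !rmorphV.
Qed.

End RingMorphisms.

Section PolynomialNome.
Variable F : fieldType.

Lemma polyC_unit (c : F) : (c%:P \is a GRing.unit) = (c != 0).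
Proof. by rewrite poly_unitE size_polyC coefC unitfE /=; case: (c != 0). Qed.

Lemma in_qpoly_eq0 (h p : {poly F}) : (in_qpoly h p == 0) = (mk_monic h %| p).
Proof.
rewrite -(inj_eq val_inj) /= /dvdp Pdiv.IdomainMonic.modpE //.
exact: monic_mk_monic.
Qed.

Lemma dvd_weierstrass_theta_prod n (x y u v : {poly F}) :
  x \is a GRing.unit -> y \is a GRing.unit -> u \is a GRing.unit -> v \is a GRing.unit ->
  'X^n %| weierstrass_defect (theta_prod 'X n) x y u v.
Proof.
move=> xU yU uU vU; case: n => [|n]; first by rewrite expr0 dvd1p.
rewrite -(mk_monic_Xn F n.+1) -in_qpoly_eq0; apply/eqP.
rewrite (rmorph_weierstrass_defect (@rmorph_theta_prod _ _ (in_qpoly _) 'X n.+1)) //.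
apply: weierstrass_theta_prod; rewrite ?rmorph_unit //.
by apply/eqP; rewrite -rmorphXn in_qpoly_eq0 mk_monic_Xn.
Qed.

Lemma horner_weierstrass_theta_prod n (q x y u v : F) :
  x != 0 -> y != 0 -> u != 0 -> v != 0 ->
  (weierstrass_defect (theta_prod 'X n) x%:P y%:P u%:P v%:P).[q] =
  weierstrass_defect (theta_prod q n) x y u v.
Proof.
move=> x0 y0 u0 v0.
have phi_theta := @rmorph_theta_prod _ _ (horner_eval q) 'X n.
rewrite -[LHS]/(horner_eval q _) (rmorph_weierstrass_defect phi_theta) ?polyC_unit //.
by rewrite /= /horner_eval hornerX !hornerC.
Qed.

End PolynomialNome.

Section Modulus.
Variable R : realType.
Implicit Types z w : Cplx R.

Definition modulus z : R := complex.Re (`|z| : R[i]).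

Lemma modulusE z : `|z| = ((modulus z)%:C : R[i]).
Proof. by rewrite /modulus normc_def. Qed.

Lemma modulus_ge0 z : 0 <= modulus z.
Proof. by rewrite -ler0c -modulusE normr_ge0. Qed.

Lemma modulusM z w : modulus (z * w) = modulus z * modulus w.
Proof. by apply: complexI; rewrite rmorphM /= -!modulusE normrM. Qed.

Lemma modulusX z n : modulus (z ^+ n) = modulus z ^+ n.
Proof. by apply: complexI; rewrite rmorphXn /= -!modulusE normrX. Qed.

Lemma modulusV z : modulus z^-1 = (modulus z)^-1.
Proof. by apply: complexI; rewrite fmorphV /= -!modulusE normfV. Qed.

Lemma modulusN z : modulus (- z) = modulus z.
Proof. by rewrite /modulus normrN. Qed.

Lemma modulus1 : modulus 1 = 1.
Proof. by rewrite /modulus normr1. Qed.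

Lemma modulus0 : modulus 0 = 0.
Proof. by rewrite /modulus normr0. Qed.

Lemma modulus_eq0 z : (modulus z == 0) = (z == 0).
Proof. by rewrite -(inj_eq (@complexI R)) -modulusE normr_eq0. Qed.

Lemma modulusD z w : modulus (z + w) <= modulus z + modulus w.
Proof. by rewrite -lecR rmorphD /= -!modulusE ler_normD. Qed.

Lemma modulus_sum (I : Type) (s : seq I) (F : I -> Cplx R) :
  modulus (\sum_(i <- s) F i) <= \sum_(i <- s) modulus (F i).
Proof.
elim/big_ind2: _ => [|x a y b xa yb|i _] //; first by rewrite modulus0.
by rewrite (le_trans (modulusD _ _)) // lerD.
Qed.

Lemma modulus_prod (I : Type) (s : seq I) (F : I -> Cplx R) :
  modulus (\prod_(i <- s) F i) = \prod_(i <- s) modulus (F i).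
Proof. exact: (big_morph _ modulusM modulus1). Qed.

Lemma modulus_pos (t : R) : 0 < t -> modulus (t%:C : Cplx R) = t.
Proof. by move=> t0; rewrite /modulus normc_def /= expr0n addr0 sqrtr_sqr gtr0_norm. Qed.

Lemma real_complex_neq0 (t : R) : 0 < t -> (t%:C : Cplx R) != 0.
Proof. by move=> t0; rewrite -modulus_eq0 modulus_pos ?gt_eqF. Qed.

Lemma modulus_lt z (r : R) : (`|z| < (r%:C : Cplx R)) = (modulus z < r).
Proof. by rewrite modulusE ltcR. Qed.

Lemma modulus_lt1 z : (`|z| < 1) = (modulus z < 1).
Proof. exact: (modulus_lt z 1). Qed.

Lemma modulus_lt1_between z : modulus z < 1 -> exists2 r, modulus z < r & 0 < r < 1.
Proof.
have := modulus_ge0 z; exists ((modulus z + 1) / 2); first by lra.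
by apply/andP; split; lra.
Qed.

Lemma modulus_Re_Im z :
  [/\ `|complex.Re (z : R[i])| <= modulus z, `|complex.Im (z : R[i])| <= modulus z
    & modulus z <= `|complex.Re (z : R[i])| + `|complex.Im (z : R[i])|].
Proof.
rewrite /modulus normc_def /=; set a := complex.Re _; set b := complex.Im _; split.
- by rewrite -sqrtr_sqr ler_wsqrtr // lerDl sqr_ge0.
- by rewrite -sqrtr_sqr ler_wsqrtr // lerDr sqr_ge0.
rewrite -[leRHS]ger0_norm ?addr_ge0 // -sqrtr_sqr ler_wsqrtr //.
have := normr_ge0 a; have := normr_ge0 b.
rewrite -(real_normK (num_real a)) -(real_normK (num_real b)); nra.
Qed.

Lemma cvg_modulusP (w : nat -> Cplx R) (l : Cplx R) :
  (w @ \oo --> l) <-> (fun n => modulus (w n - l)) @ \oo --> (0 : R).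
Proof.
split=> [/cvgrPdist_lt wl|/cvgr0Pnorm_lt wl].
  apply/cvgr0Pnorm_lt => e e0; near=> n.
  rewrite ger0_norm ?modulus_ge0 // -modulus_lt distrC.
  by near: n; apply: wl; rewrite ltcR.
apply/cvgrPdist_lt => e e0.
have eE : e = (complex.Re (e : R[i]))%:C :> R[i] by rewrite RRe_real ?gtr0_real.
near=> n; rewrite distrC eE modulus_lt -[ltLHS]ger0_norm ?modulus_ge0 //.
by near: n; apply: wl; rewrite -ltcR -eE.
Unshelve. all: by end_near. Qed.

End Modulus.

Section RealBounds.
Variable R : realType.
Implicit Types (u : nat -> R) (C r : R).

Lemma geometric_series_le C r n :
  0 <= C -> 0 <= r < 1 -> series (geometric C r) n <= C / (1 - r).
Proof.
move=> C0 /andP[r0 r1]; rewrite geometric_seriesE ?lt_eqF //.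
by rewrite ler_wpM2r ?invr_ge0 ?subr_ge0 ?(ltW r1) // ler_piMr // gerBl exprn_ge0.
Qed.

Lemma prod1D_le_expR u n : (forall k, 0 <= u k) ->
  \prod_(0 <= k < n) (1 + u k) <= expR (series u n).
Proof.
move=> u0; rewrite /series /=; elim: n => [|n IHn]; first by rewrite !big_nil expR0.
rewrite !big_nat_recr //= expRD ler_pM ?expR_ge1Dx ?addr_ge0 //.
by apply: prodr_ge0 => k _; rewrite addr_ge0.
Qed.

Lemma prod1D_geometric_le u C r n :
  0 <= r < 1 -> (forall k, 0 <= u k <= C * r ^+ k) ->
  \prod_(0 <= k < n) (1 + u k) <= expR (C / (1 - r)).
Proof.
move=> r01 uC; have /andP[u0 uC0] := uC 0%N.
apply: le_trans (prod1D_le_expR _ _) _; first by move=> k; have /andP[] := uC k.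
rewrite ler_expR; apply: le_trans (geometric_series_le n _ r01).
  by apply: ler_sum => k _; have /andP[] := uC k.
by rewrite (le_trans u0) // (le_trans uC0) // expr0 mulr1.
Qed.

Lemma ler_horner (P Q : {poly R}) r :
  0 <= r -> (forall i, P`_i <= Q`_i) -> P.[r] <= Q.[r].
Proof.
move=> r0 PQ; set m := maxn (size P) (size Q).
rewrite (@horner_coef_wide _ m P) ?leq_maxl // (@horner_coef_wide _ m Q) ?leq_maxr //.
by apply: ler_sum => i _; rewrite ler_wpM2r // exprn_ge0.
Qed.

End RealBounds.

Section WeightedNorm.
Variables (R : realType) (r : R).
Hypothesis r0 : 0 <= r.
Implicit Types (P Q : {poly Cplx R}) (c q : Cplx R).

Definition weighted_norm P : R := (map_poly (@modulus R) P).[r].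

Lemma coef_map_modulus P i : (map_poly (@modulus R) P)`_i = modulus P`_i.
Proof. by rewrite coef_map_id0 // modulus0. Qed.

Lemma weighted_norm_ge0 P : 0 <= weighted_norm P.
Proof.
rewrite -[leLHS](horner0 r); apply: ler_horner => // i.
by rewrite coef0 coef_map_modulus modulus_ge0.
Qed.

Lemma weighted_normD P Q : weighted_norm (P + Q) <= weighted_norm P + weighted_norm Q.
Proof.
rewrite -hornerD; apply: ler_horner => // i.
by rewrite coefD !coef_map_modulus coefD modulusD.
Qed.

Lemma weighted_normN P : weighted_norm (- P) = weighted_norm P.
Proof.
by congr horner; apply/polyP => i; rewrite !coef_map_modulus coefN modulusN.
Qed.

Lemma weighted_normM P Q : weighted_norm (P * Q) <= weighted_norm P * weighted_norm Q.
Proof.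
rewrite -hornerM; apply: ler_horner => // i.
rewrite coef_map_modulus !coefM (le_trans (modulus_sum _ _)) //.
by apply: ler_sum => j _; rewrite modulusM !coef_map_modulus.
Qed.

Lemma weighted_normCXn c n : weighted_norm (c%:P * 'X^n) = modulus c * r ^+ n.
Proof.
rewrite /weighted_norm mul_polyC.
have -> : map_poly (@modulus R) (c *: 'X^n) = modulus c *: 'X^n.
  apply/polyP => i; rewrite coef_map_modulus !coefZ !coefXn modulusM.
  by case: eqP; rewrite ?modulus1 ?modulus0.
by rewrite hornerZ hornerXn.
Qed.

Lemma modulus_horner_le P q N : 'X^N %| P -> modulus q <= r -> 0 < r ->
  modulus P.[q] <= (modulus q / r) ^+ N * weighted_norm P.
Proof.
move=> XNP qr rgt0; have q0 := modulus_ge0 q.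
have low_coef0 i : (i < N)%N -> P`_i = 0.
  by case/dvdpP: XNP => P' -> iN; rewrite coefMXn iN.
have qr1 : 0 <= modulus q / r <= 1 by rewrite divr_ge0 //= ler_pdivrMr ?mul1r.
rewrite /weighted_norm [in leRHS](@horner_coef_wide _ (size P)) ?size_poly //.
rewrite horner_coef (le_trans (modulus_sum _ _)) // mulr_sumr.
apply: ler_sum => i _; rewrite modulusM modulusX coef_map_modulus.
have [iN|Ni] := ltnP i N.
  by rewrite low_coef0 // modulus0 !mul0r mulr0.
rewrite -[in leLHS](divfK (lt0r_neq0 rgt0) (modulus q)) exprMn mulrCA.
rewrite ler_wpM2r ?mulr_ge0 ?modulus_ge0 ?exprn_ge0 //.
by case/andP: qr1 => *; exact: ler_wiXn2l.
Qed.

End WeightedNorm.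

Section WeightedBoundedness.
Variables (R : realType) (r : R).
Hypothesis r01 : 0 <= r < 1.
Implicit Types P Q : nat -> {poly Cplx R}.

Let r0 : 0 <= r. Proof. by case/andP: r01. Qed.

Definition weighted_bounded P : Prop :=
  exists M : R, forall n, weighted_norm r (P n) <= M.

Lemma weighted_bounded_cst (p : {poly Cplx R}) : weighted_bounded (fun=> p).
Proof. by exists (weighted_norm r p). Qed.

Lemma weighted_boundedB P Q :
  weighted_bounded P -> weighted_bounded Q -> weighted_bounded (fun n => P n - Q n).
Proof.
move=> [M PM] [N QN]; exists (M + N) => n.
by rewrite (le_trans (weighted_normD r0 _ _)) // weighted_normN lerD.
Qed.

Lemma weighted_boundedM P Q :
  weighted_bounded P -> weighted_bounded Q -> weighted_bounded (fun n => P n * Q n).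
Proof.
move=> [M PM] [N QN]; exists (M * N) => n.
by rewrite (le_trans (weighted_normM r0 _ _)) // ler_pM ?weighted_norm_ge0.
Qed.

Lemma weighted_bounded_prod (c : Cplx R) (e : nat -> nat) : (forall k, (k <= e k)%N) ->
  weighted_bounded (fun n => \prod_(k < n) (1 - c%:P * 'X^(e k))).
Proof.
move=> ke; exists (expR (modulus c / (1 - r))) => n.
have norm1 : weighted_norm r 1 = 1.
  by have := weighted_normCXn r 1 0; rewrite !expr0 !mulr1 modulus1.
have geometric_factors k : 0 <= modulus c * r ^+ e k <= modulus c * r ^+ k.
  rewrite mulr_ge0 ?modulus_ge0 ?exprn_ge0 //= ler_wpM2l ?modulus_ge0 //.
  by case/andP: r01 => _ /ltW r1; exact: ler_wiXn2l.
apply: le_trans (prod1D_geometric_le n r01 geometric_factors).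
rewrite big_mkord; elim/big_ind2: _ => [|P x Q y Px Qy|k _]; first by rewrite norm1.
  by rewrite (le_trans (weighted_normM r0 _ _)) // ler_pM ?weighted_norm_ge0.
by rewrite (le_trans (weighted_normD r0 _ _)) // weighted_normN weighted_normCXn norm1.
Qed.

Lemma weighted_bounded_theta_prod (z : {poly Cplx R}) : z \is a GRing.unit ->
  weighted_bounded (fun n => theta_prod 'X n z).
Proof.
have unit_const (w : {poly Cplx R}) : w \is a GRing.unit -> exists c, w = c%:P.
  by rewrite poly_unitE => /andP[/size_poly1P[c _ ->] _]; exists c.
move=> zU; have [c zE] := unit_const z zU.
have [d zVE] : exists d, z^-1 = d%:P by apply: unit_const; rewrite unitrV.
rewrite /theta_prod zVE zE; apply: weighted_boundedM; last exact: weighted_bounded_prod.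
exact: (@weighted_bounded_prod _ id).
Qed.

Lemma weighted_bounded_weierstrass (th : nat -> {poly Cplx R} -> {poly Cplx R}) x y u v :
  (forall z, z \is a GRing.unit -> weighted_bounded (th ^~ z)) ->
  x \is a GRing.unit -> y \is a GRing.unit -> u \is a GRing.unit -> v \is a GRing.unit ->
  weighted_bounded (fun n => weierstrass_defect (th n) x y u v).
Proof.
move=> th_bounded xU yU uU vU.
have bounded_prod4 a b c d : a \is a GRing.unit -> b \is a GRing.unit ->
    c \is a GRing.unit -> d \is a GRing.unit ->
    weighted_bounded (fun n => th n a * th n b * (th n c * th n d)).
  by move=> *; do 2 apply: weighted_boundedM; apply: th_bounded.
apply: weighted_boundedB; first apply: weighted_boundedB.
- by apply: bounded_prod4; rewrite unitrM ?unitrV ?xU ?yU ?uU ?vU.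
- by apply: bounded_prod4; rewrite unitrM ?unitrV ?xU ?yU ?uU ?vU.
apply: weighted_boundedM; first exact: weighted_bounded_cst.
by apply: bounded_prod4; rewrite unitrM ?unitrV ?xU ?yU ?uU ?vU.
Qed.

End WeightedBoundedness.

Lemma cvg_horner_dvdXn (R : realType) (r : R) (P : nat -> {poly Cplx R}) (q : Cplx R) :
  weighted_bounded r P -> (forall n, 'X^n %| P n) -> modulus q < r ->
  (fun n => (P n).[q]) @ \oo --> (0 : Cplx R).
Proof.
move=> [M PM] XnP qr; apply/cvg_modulusP.
have r0 : 0 < r := le_lt_trans (modulus_ge0 q) qr.
have qr0 : 0 <= modulus q / r by rewrite divr_ge0 ?modulus_ge0 // ltW.
apply: (@squeeze_cvgr _ _ _ _ (cst 0) (geometric M (modulus q / r))).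
- near=> n; rewrite modulus_ge0 /= subr0 mulrC.
  apply: le_trans (modulus_horner_le (ltW r0) (XnP n) (ltW qr) r0) _.
  by rewrite ler_wpM2l ?exprn_ge0.
- exact: cvg_cst.
by apply: cvg_geometric; rewrite ger0_norm // ltr_pdivrMr // mul1r.
Unshelve. all: by end_near. Qed.

Section InfiniteProducts.
Variable R : realType.
Implicit Types (z w : nat -> Cplx R) (C r : R).

Lemma cvg_complex (x y : nat -> R) (a b : R) :
  x @ \oo --> a -> y @ \oo --> b ->
  (fun n => (x n +i* y n)%C : Cplx R) @ \oo --> ((a +i* b)%C : Cplx R).
Proof.
move=> /cvgrPdist_lt xa /cvgrPdist_lt yb; apply/cvg_modulusP/cvgrPdist_lt => e e0.
near=> n; rewrite distrC subr0 ger0_norm ?modulus_ge0 //.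
have [_ _] := modulus_Re_Im ((x n +i* y n)%C - (a +i* b)%C : Cplx R).
move/le_lt_trans; apply; rewrite [ltRHS](splitr e) distrC [`|complex.Im _|]distrC.
by apply: ltrD; near: n; [apply: xa|apply: yb]; rewrite divr_gt0.
Unshelve. all: by end_near. Qed.

Lemma is_cvg_series_geometric_le (u : nat -> R) C r :
  0 <= r < 1 -> (forall n, `|u n| <= C * r ^+ n) -> cvgn (series u).
Proof.
move=> /andP[r0 r1] uC; apply: normed_cvg.
apply: (@series_le_cvg _ _ (geometric C r)) => // [n|n|].
- exact: normr_ge0.
- by apply: le_trans (uC n); exact: normr_ge0.
by apply: is_cvg_geometric_series; rewrite ger0_norm.
Qed.

Lemma is_cvg_seriesC_geometric_le w C r :
  0 <= r < 1 -> (forall n, modulus (w n) <= C * r ^+ n) -> cvgn (series w).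
Proof.
move=> r01 wC.
have cvgRe : cvgn (series (fun n => complex.Re (w n : R[i]))).
  apply: (is_cvg_series_geometric_le r01) => n; apply: le_trans (wC n).
  by have [] := modulus_Re_Im (w n).
have cvgIm : cvgn (series (fun n => complex.Im (w n : R[i]))).
  apply: (is_cvg_series_geometric_le r01) => n; apply: le_trans (wC n).
  by have [] := modulus_Re_Im (w n).
apply/cvg_ex; eexists; apply: cvg_trans (cvg_complex cvgRe cvgIm).
apply: near_eq_cvg; near=> n => /=.
elim: (n) => [|m IHm]; rewrite /series /= ?big_nil // !big_nat_recr //=.
by rewrite -[X in _ = X + _]IHm; case: (w m).
Unshelve. all: by end_near. Qed.

Lemma is_cvg_infinite_prod z C r :
  0 <= r < 1 -> (forall k, modulus (z k) <= C * r ^+ k) ->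
  cvgn (fun n => \prod_(0 <= k < n) (1 + z k)).
Proof.
move=> r01 zC; set P := fun n => _.
have -> : P = (fun n => 1 + series (telescope P) n).
  apply/funext => n; rewrite [LHS](eq_sum_telescope P); congr (_ + _).
  by rewrite /P big_nil.
apply: is_cvgD; first exact: is_cvg_cst.
apply: (@is_cvg_seriesC_geometric_le _ (expR (C / (1 - r)) * C) r r01) => n.
have -> : telescope P n = P n * z n by rewrite /telescope /= /P big_nat_recr //=; ring.
rewrite modulusM -mulrA ler_pM ?modulus_ge0 // modulus_prod.
have mod_zC k : 0 <= modulus (z k) <= C * r ^+ k by rewrite modulus_ge0 zC.
apply: le_trans (prod1D_geometric_le n r01 mod_zC).
by apply: ler_prod => k _; rewrite modulus_ge0 (le_trans (modulusD _ _)) // modulus1.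
Qed.

End InfiniteProducts.

Definition theta (K : numFieldType) (q z : K) : K := qpoch z q * qpoch (q / z) q.

Lemma theta_reflect (K : numFieldType) (q z : K) :
  q != 0 -> theta q (q / z) = theta q z.
Proof. by move=> q0; rewrite /theta invf_div mulrCA divff // mulr1 mulrC. Qed.

Lemma qpoch0 (K : numFieldType) (q : K) : qpoch 0 q = 1.
Proof.
rewrite /qpoch (_ : (fun n => _) = cst 1) ?lim_cst //.
by apply/funext => n; rewrite big1 // => k _; rewrite mul0r subr0.
Qed.

Lemma qpochs_theta (K : numFieldType) (z w q : K) :
  z != 0 -> z * w = q -> qpochs [:: z; w] q = theta q z.
Proof.
by move=> z0 <-; rewrite /qpochs !big_cons big_nil mulr1 /theta mulrAC divff // mul1r.
Qed.

Definition a_product (K : numFieldType) (q : K) : K :=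
  qpochs [:: - q; - q ^+ 4] (q ^+ 5) * qpochs [:: q; q ^+ 9] (q ^+ 10) ^+ 3.

Definition b_product (K : numFieldType) (q : K) : K :=
  qpochs [:: - q ^+ 2; - q ^+ 3] (q ^+ 5) * qpochs [:: q ^+ 3; q ^+ 7] (q ^+ 10) ^+ 3.

Lemma cvgn_unique (K : numFieldType) (w : nat -> K) (l l' : K) :
  w @ \oo --> l -> w @ \oo --> l' -> l = l'.
Proof. exact: (cvg_unique (@norm_hausdorff _ K)). Qed.

Lemma cvg_inverse_neq0 (K : numFieldType) (w w' : nat -> K) (l l' : K) :
  w @ \oo --> l -> w' @ \oo --> l' -> (forall n, w n * w' n = 1) -> l != 0.
Proof.
move=> wl wl' ww'; have ww'1 : w \* w' = cst 1 by apply/funext.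
apply/eqP => l0; have := cvgM wl wl'; rewrite ww'1 l0 mul0r => /(_ _).
by move/(cvgn_unique (cvg_cst (1 : K)))/eqP; rewrite oner_eq0.
Qed.

Lemma cvg_weierstrass_defect (K : numFieldType) (th : nat -> K -> K) (th_lim : K -> K)
    (x y u v : K) :
  (forall z, th ^~ z @ \oo --> th_lim z) ->
  weierstrass_defect (th n) x y u v @[n --> \oo] --> weierstrass_defect th_lim x y u v.
Proof.
move=> th_cvg; have cvg_prod4 a b c d : th n a * th n b * (th n c * th n d) @[n --> \oo] -->
    th_lim a * th_lim b * (th_lim c * th_lim d).
  by apply: cvgM; apply: cvgM; apply: th_cvg.
by apply: cvgB; [apply: cvgB|apply: cvgM; first exact: cvg_cst]; apply: cvg_prod4.
Qed.

Section ThetaIdentities.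
Variable K : numFieldType.
Hypothesis cvg_qpoch : forall z q : K, `|q| < 1 ->
  (fun n : nat => \prod_(0 <= k < n) (1 - z * q ^+ k)) @ \oo --> qpoch z q.
Implicit Types q z : K.

Lemma norm_expr_lt1 q n : `|q| < 1 -> (0 < n)%N -> `|q ^+ n| < 1.
Proof. by move=> q1 n0; rewrite normrX exprn_ilt1 // -lt0n. Qed.

Lemma qpoch_mulN z q : `|q| < 1 ->
  qpoch z q * qpoch (- z) q = qpoch (z ^+ 2) (q ^+ 2).
Proof.
move=> q1; have q21 : `|q ^+ 2| < 1 by exact: norm_expr_lt1.
apply: (cvgn_unique _ (cvg_qpoch (z := z ^+ 2) q21)).
apply: cvg_trans (cvgM (cvg_qpoch (z := z) q1) (cvg_qpoch (z := - z) q1)).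
apply: near_eq_cvg; near=> n => /=.
rewrite -big_split /=; apply: eq_bigr => k _.
by rewrite exprAC; ring.
Unshelve. all: by end_near. Qed.

Lemma qpoch_bisect z q : `|q| < 1 ->
  qpoch z q = qpoch z (q ^+ 2) * qpoch (z * q) (q ^+ 2).
Proof.
move=> q1; have q21 : `|q ^+ 2| < 1 by exact: norm_expr_lt1.
apply: (cvgn_unique _ (cvgM (cvg_qpoch (z := z) q21) (cvg_qpoch (z := z * q) q21))).
apply: cvg_trans (cvg_comp _ _ (@cvg_mulnr 2 isT) (cvg_qpoch (z := z) q1)).
apply: near_eq_cvg; near=> n => /=.
rewrite big_nat_mul -big_split /=; apply: eq_bigr => k _.
by rewrite mulSn big_ltn // big_nat1 -!exprM mulnC -mulrA -exprS.
Unshelve. all: by end_near. Qed.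

Lemma theta_mulN q z : `|q| < 1 -> theta q z * theta q (- z) = theta (q ^+ 2) (z ^+ 2).
Proof.
by move=> q1; rewrite /theta invrN mulrN -expr_div_n -!qpoch_mulN //; ring.
Qed.

Lemma theta_bisect q z : `|q| < 1 ->
  theta q z = theta (q ^+ 2) z * theta (q ^+ 2) (z * q).
Proof.
move=> q1; rewrite /theta !(@qpoch_bisect _ q) // invfM.
have -> : q ^+ 2 * (z^-1 * q^-1) = q / z.
  have [->|q0] := eqVneq q 0; first by rewrite !mul0r expr0n mul0r.
  by rewrite expr2 mulrACA divff // mulr1.
by rewrite (_ : q ^+ 2 / z = q / z * q); ring.
Qed.

Lemma cvg_theta_prod q z : `|q| < 1 -> (fun n => theta_prod q n z) @ \oo --> theta q z.
Proof.
move=> q1; apply: cvg_trans (cvgM (cvg_qpoch (z := z) q1) (cvg_qpoch (z := q / z) q1)).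
apply: near_eq_cvg; near=> n => /=; rewrite /theta_prod !big_mkord.
by congr (_ * _); apply: eq_bigr => k _; rewrite exprS; ring.
Unshelve. all: by end_near. Qed.

Section DecicTheta.
Variable q : K.
Hypotheses (q1 : `|q| < 1) (q0 : q != 0).
Hypothesis qpoch_neq0 : forall z p : K, `|p| < 1 -> `|z| < 1 -> qpoch z p != 0.
Hypothesis weierstrass_theta : forall p x y u v : K, `|p| < 1 ->
  x != 0 -> y != 0 -> u != 0 -> v != 0 -> weierstrass_defect (theta p) x y u v = 0.
Hypothesis square_root : exists s, s ^+ 2 = q.

Local Notation T i := (theta (q ^+ 10) (q ^+ i)).

Let expr_lt1 n : (0 < n)%N -> `|q ^+ n| < 1.
Proof. exact: norm_expr_lt1. Qed.

Lemma decic_theta_reflect i : (i <= 10)%N -> T (10 - i) = T i.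
Proof. by move=> i10; rewrite expfB_cond ?(negPf q0) // theta_reflect // expf_neq0. Qed.

Lemma decic_theta_neq0 i : (0 < i < 10)%N -> T i != 0.
Proof.
move=> /andP[i0 i10]; rewrite /theta -expfB // mulf_neq0 // qpoch_neq0 ?expr_lt1 //.
by rewrite subn_gt0.
Qed.

Lemma decic_thetaN i : (0 < i < 5)%N ->
  theta (q ^+ 5) (- q ^+ i) = T (2 * i) / (T i * T (i + 5)).
Proof.
move=> i5; have T0 : T i * T (i + 5) != 0 by rewrite mulf_neq0 ?decic_theta_neq0 //; lia.
apply: (mulfI T0); rewrite [RHS]mulrCA divff // mulr1.
have := theta_mulN (q ^+ i) (expr_lt1 (isT : (0 < 5)%N)).
rewrite (theta_bisect _ (expr_lt1 (isT : (0 < 5)%N))) -!exprM -exprD.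
by rewrite [(i * 2)%N]mulnC.
Qed.

Lemma decic_theta_identity :
  T 4 ^+ 2 * T 3 ^+ 2 - q ^+ 2 * (T 1 ^+ 2 * T 2 ^+ 2) = T 5 ^+ 2 * (T 2 * T 4).
Proof.
have [s sq] := square_root.
have s0 n : s ^+ n != 0 by rewrite expf_neq0 // -sqrf_eq0 sq.
have mulE m n k : (m + n = 2 * k)%N -> s ^+ m * s ^+ n = q ^+ k.
  by rewrite -exprD -sq -exprM => ->.
have divE m n k : (m = n + 2 * k)%N -> s ^+ m / s ^+ n = q ^+ k.
  by move=> ->; rewrite exprD -sq -exprM mulrAC divff ?mul1r.
have := weierstrass_theta (expr_lt1 (isT : (0 < 10)%N)) (s0 9%N) (s0 3%N) (s0 7%N) (s0 1%N).
rewrite /weierstrass_defect.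
rewrite (mulE 9 3 6)%N // (divE 9 3 3)%N // (mulE 7 1 4)%N // (divE 7 1 3)%N //.
rewrite (mulE 9 1 5)%N // (divE 9 1 4)%N // (mulE 7 3 5)%N // (divE 7 3 2)%N //.
rewrite (mulE 9 7 8)%N // (divE 9 7 1)%N // (mulE 3 1 2)%N // (divE 3 1 1)%N //.
rewrite (@decic_theta_reflect 4) // (@decic_theta_reflect 2) // => weierstrass0.
by apply/eqP; rewrite -subr_eq0; apply/eqP; rewrite -[RHS]weierstrass0; ring.
Qed.

Lemma eulerf_quotient : eulerf 1 (q ^+ 5) ^+ 4 / eulerf 2 (q ^+ 5) ^+ 4 = T 5 ^+ 2.
Proof.
have [q5 q10] := (expr_lt1 (isT : (0 < 5)%N), expr_lt1 (isT : (0 < 10)%N)).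
have eulerf2_neq0 : eulerf 2 (q ^+ 5) != 0 by rewrite /eulerf -exprM qpoch_neq0.
have -> : eulerf 1 (q ^+ 5) = qpoch (q ^+ 5) (q ^+ 10) * eulerf 2 (q ^+ 5).
  by rewrite /eulerf expr1 (qpoch_bisect _ q5) -expr2 -!exprM.
rewrite exprMn mulfK ?expf_neq0 // /theta -expfB //.
by rewrite -expr2 -exprM.
Qed.

Lemma decic_product_identity :
  b_product q - q ^+ 2 * a_product q = eulerf 1 (q ^+ 5) ^+ 4 / eulerf 2 (q ^+ 5) ^+ 4.
Proof.
have -> : b_product q = theta (q ^+ 5) (- q ^+ 2) * T 3 ^+ 3.
  by rewrite /b_product !qpochs_theta ?oppr_eq0 ?expf_neq0 //; ring.
have -> : a_product q = theta (q ^+ 5) (- q ^+ 1) * T 1 ^+ 3.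
  by rewrite /a_product !qpochs_theta ?oppr_eq0 //; ring.
have [T1 T2 T3 T4] : [/\ T 1 != 0, T 2 != 0, T 3 != 0 & T 4 != 0].
  by split; exact: decic_theta_neq0.
rewrite !decic_thetaN // (@decic_theta_reflect 4) // (@decic_theta_reflect 3) //.
rewrite eulerf_quotient; apply: (mulIf (mulf_neq0 T2 T4)).
by rewrite -decic_theta_identity; field; rewrite T1 T2 T3 T4.
Qed.

End DecicTheta.

End ThetaIdentities.

Section ComplexQPochhammer.
Variable R : realType.
Implicit Types q x y z u v : Cplx R.

Lemma qpoch_factor_le z q k : modulus (- (z * q ^+ k)) <= modulus z * modulus q ^+ k.
Proof. by rewrite modulusN modulusM modulusX. Qed.

Lemma cvg_qpoch z q : `|q| < 1 ->
  (fun n : nat => \prod_(0 <= k < n) (1 - z * q ^+ k)) @ \oo --> qpoch z q.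
Proof.
rewrite modulus_lt1 => q1; apply: is_cvg_infinite_prod (qpoch_factor_le z q).
by rewrite modulus_ge0.
Qed.

(* The inverses [1 / (1 - z q^k) = 1 + z q^k / (1 - z q^k)] also have a convergent
   product. *)
Lemma qpoch_neq0 z q : `|q| < 1 -> `|z| < 1 -> qpoch z q != 0.
Proof.
move=> q1; rewrite modulus_lt1 => z1.
have q01 : 0 <= modulus q < 1 by rewrite modulus_ge0 -modulus_lt1.
have factor_ge k : 1 - modulus z <= modulus (1 - z * q ^+ k).
  have zqk : modulus (z * q ^+ k) <= modulus z.
    rewrite modulusM modulusX ler_piMr ?modulus_ge0 // exprn_ile1 ?modulus_ge0 //.
    by case/andP: q01 => _ /ltW.
  by have := modulusD (1 - z * q ^+ k) (z * q ^+ k); rewrite subrK modulus1; lra.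
have z1' : 0 < 1 - modulus z by rewrite subr_gt0.
have factor_neq0 k : 1 - z * q ^+ k != 0.
  by rewrite -modulus_eq0 gt_eqF // (lt_le_trans z1').
pose w k := z * q ^+ k / (1 - z * q ^+ k).
have w_le k : modulus (w k) <= modulus z / (1 - modulus z) * modulus q ^+ k.
  rewrite modulusM modulusV modulusM modulusX mulrAC.
  rewrite ler_wpM2r ?exprn_ge0 ?modulus_ge0 // ler_wpM2l ?modulus_ge0 //.
  by rewrite lef_pV2 // posrE (lt_le_trans z1').
have /cvg_ex[l wl] := is_cvg_infinite_prod q01 w_le.
apply: (cvg_inverse_neq0 (cvg_qpoch (z := z) q1) wl) => n.
rewrite -big_split big1 // => k _ /=.
by rewrite /w mulrDr mulr1 mulrCA divff // mulr1 subrK.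
Qed.

Lemma weierstrass_theta q x y u v :
  `|q| < 1 -> x != 0 -> y != 0 -> u != 0 -> v != 0 ->
  weierstrass_defect (theta q) x y u v = 0.
Proof.
move=> q1 x0 y0 u0 v0.
have [xU yU uU vU] : [/\ x%:P \is a GRing.unit, y%:P \is a GRing.unit,
    u%:P \is a GRing.unit & v%:P \is a GRing.unit] by rewrite !polyC_unit.
have [r qr /andP[r0 r1]] : exists2 r, modulus q < r & 0 < r < 1.
  by apply: modulus_lt1_between; rewrite -modulus_lt1.
have r01 : 0 <= r < 1 by rewrite ltW.
have defect_cvg0 := cvg_horner_dvdXn
  (weighted_bounded_weierstrass r01 (weighted_bounded_theta_prod r01) xU yU uU vU)
  (fun n => dvd_weierstrass_theta_prod n xU yU uU vU) qr.
apply: cvgn_unique defect_cvg0.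
have := @cvg_weierstrass_defect _ _ _ x y u v (fun z => cvg_theta_prod cvg_qpoch (z := z) q1).
apply: cvg_trans; apply: near_eq_cvg; near=> n.
by rewrite horner_weierstrass_theta_prod.
Unshelve. all: by end_near. Qed.

Lemma decic_product_identityC q : `|q| < 1 ->
  b_product q - q ^+ 2 * a_product q = eulerf 1 (q ^+ 5) ^+ 4 / eulerf 2 (q ^+ 5) ^+ 4.
Proof.
move=> q1; have [->|q0] := eqVneq q 0.
  rewrite /b_product /a_product !expr0n /= /qpochs !big_cons big_nil /eulerf !expr0n /= !oppr0 !qpoch0.
  by rewrite !(mul0r, mulr1, mul1r, expr1n, invr1, subr0).
apply: (decic_product_identity cvg_qpoch q1 q0 qpoch_neq0 weierstrass_theta).
by exists (2.-root (q : R[i])); exact: rootCK.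
Qed.

End ComplexQPochhammer.

Lemma prime_primitive_root (F : numClosedFieldType) m : prime m ->
  exists z : F, m.-primitive_root z.
Proof.
move=> m_prime; have m1 := prime_gt1 m_prime.
have [|z] := @solve_monicpoly F m.-1 (fun=> -1); first by lia.
move=> zE; have sum_z : \sum_(k < m) z ^+ k = 0.
  rewrite -(prednK (ltnW m1)) big_ord_recr /= zE -big_split big1 // => k _ /=.
  by rewrite mulN1r subrr.
have zm1 : z ^+ m = 1 by apply/eqP; rewrite -subr_eq0 subrX1 sum_z mulr0.
have [k zk km] := prim_order_exists (ltnW m1) zm1; exists z.
have /orP[/eqP k1|/eqP <- //] := (primeP m_prime).2 k km.
move: sum_z; have := prim_expr_order zk; rewrite k1 expr1 => ->.
under eq_bigr do rewrite expr1n.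
by rewrite sumr_const card_ord => /eqP; rewrite pnatr_eq0 => /eqP m0; rewrite m0 in m1.
Qed.

Definition power_series (K : nzRingType) (u : nat -> K) (x : K) (N : nat) : K :=
  \sum_(0 <= n < N) u n * x ^+ n.

Section PowerSeriesAlgebra.
Variable K : numFieldType.
Implicit Types (u v : nat -> K) (x z l : K).

Lemma cvg_power_seriesB u v x l l' :
  power_series u x @ \oo --> l -> power_series v x @ \oo --> l' ->
  power_series (fun n => u n - v n) x @ \oo --> l - l'.
Proof.
move=> ul vl; apply: cvg_trans (cvgB ul vl); apply: near_eq_cvg; near=> N => /=.
by rewrite fctE /power_series -sumrB; apply: eq_bigr => n _; rewrite mulrBl.
Unshelve. all: by end_near. Qed.

Lemma power_series_scale u z x :
  power_series u (z * x) = power_series (fun n => u n * z ^+ n) x.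
Proof. by apply/funext => N; apply: eq_bigr => n _; rewrite exprMn mulrA. Qed.

Lemma cvg_power_series_shift k u v x l :
  (forall n, (n < k)%N -> v n = 0) -> (forall n, v (n + k)%N = u n) ->
  power_series u x @ \oo --> l -> power_series v x @ \oo --> x ^+ k * l.
Proof.
move=> v0 vu ul; rewrite -(cvg_shiftn k).
have head0 : \sum_(0 <= n < k) v n * x ^+ n = 0.
  by rewrite big_nat big1 // => n /andP[_ nk]; rewrite v0 ?mul0r.
apply: cvg_trans (cvgM (cvg_cst (x ^+ k)) ul); apply: near_eq_cvg; near=> N => /=.
rewrite /power_series addnC [RHS](@big_cat_nat _ _ _ k) ?leq_addr //= head0 add0r.
rewrite (big_addn 0 _ k) addKn mulr_sumr; apply: eq_bigr => n _.
by rewrite vu exprD; ring.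
Unshelve. all: by end_near. Qed.

Lemma cvg_power_series_behead u x l : u 0%N = 0 -> x != 0 ->
  power_series u x @ \oo --> l -> power_series (fun n => u n.+1) x @ \oo --> x^-1 * l.
Proof.
move=> u0 x0; rewrite -cvg_shiftS => ul.
apply: cvg_trans (cvgM (cvg_cst x^-1) ul); apply: near_eq_cvg; near=> N => /=.
rewrite /power_series big_nat_recl //= u0 mul0r add0r mulr_sumr; apply: eq_bigr => n _.
by rewrite exprS mulrCA mulKf.
Unshelve. all: by end_near. Qed.

Lemma power_series_multiples m u x N : (0 < m)%N ->
  (forall n, ~~ (m %| n)%N -> u n = 0) ->
  power_series u x (N * m) = power_series (fun n => u (m * n)%N) (x ^+ m) N.
Proof.
case: m => // m _ u0; rewrite /power_series big_nat_mul; apply: eq_bigr => n _.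
rewrite [(n.+1 * _)%N]mulSn addSn big_ltn ?ltnS ?leq_addl // big_nat big1 /= ?addr0.
  by rewrite [(n * _)%N]mulnC exprM.
move=> k /andP[nk kn]; rewrite u0 ?mul0r //; apply/negP => /dvdnP[j kE].
have nj : (n < j)%N by rewrite -(ltn_pmul2r (ltn0Sn m)) -kE.
have : (j < n.+1)%N by rewrite -(ltn_pmul2r (ltn0Sn m)) -kE mulSn addSn ltnS.
by rewrite ltnNge nj.
Qed.

End PowerSeriesAlgebra.

Section ComplexPowerSeries.
Variable R : realType.
Implicit Types (u v : nat -> Cplx R) (x y : Cplx R).

Lemma exists_root_lt1 m x : (0 < m)%N -> `|x| < 1 ->
  exists2 y, `|y| < 1 & y ^+ m = x.
Proof.
move=> m0 x1; have rootK := rootCK m0 (x : R[i]); exists (m.-root (x : R[i])) => //.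
by rewrite -(@ltr_pXn2r _ m) ?nnegrE // expr1n -normrX rootK.
Qed.

Lemma power_series_abel_le u y : y != 0 -> cvgn (power_series u y) ->
  exists M, forall n x, modulus (u n * x ^+ n) <= M * (modulus x / modulus y) ^+ n.
Proof.
rewrite -modulus_eq0 => y0.
move=> /cvg_series_cvg_0/cvg_modulusP/cvgP/cvg_seq_bounded/bounded_fun_has_ubound[M uM].
exists M => n x; have {uM} : modulus (u n * y ^+ n) <= M.
  by rewrite -[u n * _]subr0; apply: uM; exists n.
rewrite !modulusM !modulusX expr_div_n mulrA ler_pdivlMr; last first.
  by rewrite exprn_gt0 // lt_def y0 modulus_ge0.
by move=> uM; rewrite mulrAC ler_wpM2r ?exprn_ge0 ?modulus_ge0.
Qed.

Lemma is_cvg_power_series_section m u : (0 < m)%N ->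
  (forall x, `|x| < 1 -> cvgn (power_series u x)) ->
  forall x, `|x| < 1 -> cvgn (power_series (fun n => u (m * n)%N) x).
Proof.
move=> m0 u_cvg x x1.
have [z] := exists_root_lt1 m0 x1; rewrite modulus_lt1 => z1 zm.
have [r zr /andP[r0 r1]] := modulus_lt1_between z1.
have /(power_series_abel_le (real_complex_neq0 r0))[M uM] :
    cvgn (power_series u (r%:C : Cplx R)).
  by apply: u_cvg; rewrite modulus_lt1 modulus_pos.
rewrite modulus_pos // in uM.
apply: (@is_cvg_seriesC_geometric_le _ _ M ((modulus z / r) ^+ m)) => [|n].
  have ratio0 : 0 <= modulus z / r by rewrite divr_ge0 ?modulus_ge0 // ltW.
  by rewrite exprn_ge0 //= exprn_ilt1 // -?lt0n // ltr_pdivrMr // mul1r.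
by rewrite -zm -!exprM.
Qed.

Lemma power_series_head_le u x (M r : R) N :
  (forall n, modulus (u n) <= M * r ^+ n) -> 0 <= r -> r * modulus x <= 1 / 2 ->
  modulus (power_series u x N.+1 - u 0%N) <= 2 * M * (r * modulus x).
Proof.
move=> uM r0 rx; have x0 := modulus_ge0 x.
have M0 : 0 <= M by have := uM 0%N; rewrite expr0 mulr1; apply: le_trans (modulus_ge0 _).
have rx0 : 0 <= r * modulus x by rewrite mulr_ge0.
rewrite /power_series big_nat_recl // expr0 mulr1 addrC addKr.
rewrite (le_trans (modulus_sum _ _)) //.
apply: (@le_trans _ _ (series (geometric (M * (r * modulus x)) (r * modulus x)) N)).
  apply: ler_sum => n _; rewrite modulusM modulusX /=.
  apply: (@le_trans _ _ (M * r ^+ n.+1 * modulus x ^+ n.+1)).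
    by rewrite ler_wpM2r ?exprn_ge0.
  by rewrite -mulrA -exprMn exprS [leLHS]mulrA.
apply: le_trans (geometric_series_le _ _ _) _; first by rewrite mulr_ge0.
  by apply/andP; split; lra.
rewrite ler_pdivrMr; last by lra.
have : 0 <= M * (r * modulus x) by rewrite mulr_ge0.
move: (r * modulus x) rx => t; nra.
Qed.

Lemma power_series_lim_head_le u x l (M r : R) :
  (forall n, modulus (u n) <= M * r ^+ n) -> 0 <= r -> r * modulus x <= 1 / 2 ->
  power_series u x @ \oo --> l -> modulus (l - u 0%N) <= 2 * M * (r * modulus x).
Proof.
move=> uM r0 rx; rewrite -cvg_shiftS => /cvg_modulusP ul.
rewrite -[leRHS]add0r -lerBlDr; apply: (cvgr_to_ge ul); near=> N => /=.
have := power_series_head_le N uM r0 rx; set s := power_series _ _ _.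
have := modulusD (l - s) (s - u 0%N); rewrite addrA subrK -[l - s]opprB modulusN; lra.
Unshelve. all: by end_near. Qed.

Lemma power_series_head_eq0 u :
  (forall x, x != 0 -> `|x| < 1 -> power_series u x @ \oo --> (0 : Cplx R)) -> u 0%N = 0.
Proof.
move=> u_cvg0.
have u_cvg0_real (t : R) : 0 < t -> t < 1 ->
      power_series u (t%:C : Cplx R) @ \oo --> (0 : Cplx R).
  move=> t0 t1; apply: u_cvg0; first exact: real_complex_neq0.
  by rewrite modulus_lt1 modulus_pos.
have half_gt0 : 0 < 2^-1 :> R by rewrite invr_gt0.
have [M uM] : exists M : R, forall n, modulus (u n) <= M * 2 ^+ n.
  have /cvgP/(power_series_abel_le (real_complex_neq0 half_gt0))[M uM] :
      power_series u ((2^-1)%:C : Cplx R) @ \oo --> (0 : Cplx R).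
    by apply: u_cvg0_real; lra.
  exists M => n; have := uM n 1.
  by rewrite expr1n mulr1 modulus1 modulus_pos // invrK mul1r.
have M0 : 0 <= M by have := uM 0%N; rewrite expr0 mulr1; apply: le_trans (modulus_ge0 _).
apply/eqP; rewrite -modulus_eq0; apply/eqP/le_anti; rewrite modulus_ge0 andbT.
apply/ler_addgt0Pr => e e0; rewrite add0r.
pose t := e / (4 * (M + 1 + e)).
have t0 : 0 < t by rewrite divr_gt0 //; lra.
have tE : t * (4 * (M + 1 + e)) = e by rewrite divfK // gt_eqF //; lra.
have t4 : t <= 1 / 4 by rewrite /t ler_pdivrMr; lra.
have := @power_series_lim_head_le u t%:C 0 M 2 uM (ler0n _ 2).
rewrite modulus_pos // sub0r modulusN => head_le; apply: (@le_trans _ _ (2 * M * (2 * t))).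
  by apply: head_le; [lra|apply: u_cvg0_real; lra].
by nra.
Qed.

Lemma power_series_eq0 u :
  (forall x, `|x| < 1 -> power_series u x @ \oo --> (0 : Cplx R)) -> forall n, u n = 0.
Proof.
move=> u_cvg0 n.
have {}u_cvg0 x : x != 0 -> `|x| < 1 -> power_series u x @ \oo --> (0 : Cplx R).
  by move=> _; exact: u_cvg0.
elim: n u u_cvg0 => [|n IHn] u u_cvg0; first exact: power_series_head_eq0.
apply: (IHn (fun k => u k.+1)) => x x0 x1; rewrite -(mulr0 x^-1).
exact: cvg_power_series_behead (power_series_head_eq0 u_cvg0) x0 (u_cvg0 x x0 x1).
Qed.

(* Replacing [x] by [z x] does not change [F (x ^ m)]. *)
Lemma power_series_support_multiples m (z : Cplx R) u (F : Cplx R -> Cplx R) :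
  m.-primitive_root z ->
  (forall x, `|x| < 1 -> power_series u x @ \oo --> F (x ^+ m)) ->
  forall n, ~~ (m %| n)%N -> u n = 0.
Proof.
move=> zprim uF n; rewrite (prim_order_dvd zprim) -subr_eq0 => zn1; apply: (mulIf zn1).
have z1 : `|z| = 1.
  apply/eqP; rewrite -(@pexpr_eq1 _ _ m) ?normr_ge0 ?(prim_order_gt0 zprim) //.
  by rewrite -normrX prim_expr_order // normr1.
rewrite mul0r mulrBr mulr1; apply: (@power_series_eq0 (fun n => u n * z ^+ n - u n)) => x x1.
have zx1 : `|z * x| < 1 by rewrite normrM z1 mul1r.
have := uF _ zx1; rewrite power_series_scale exprMn (prim_expr_order zprim) mul1r => uFz.
by rewrite -(subrr (F (x ^+ m))); exact: cvg_power_seriesB uFz (uF x x1).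
Qed.

Lemma cvg_power_series_section m u (F : Cplx R -> Cplx R) :
  (0 < m)%N -> (forall n, ~~ (m %| n)%N -> u n = 0) ->
  (forall x, `|x| < 1 -> power_series u x @ \oo --> F (x ^+ m)) ->
  forall x, `|x| < 1 -> power_series (fun n => u (m * n)%N) x @ \oo --> F x.
Proof.
move=> m0 u0 uF x x1; have [y y1 <-] := exists_root_lt1 m0 x1.
apply: cvg_trans (cvg_comp _ _ (@cvg_mulnr m m0) (uF y y1)).
by apply: near_eq_cvg; near=> N => /=; rewrite (power_series_multiples _ _ m0 u0).
Unshelve. all: by end_near. Qed.

Lemma power_series_prime_section m u v (U V F : Cplx R -> Cplx R) : prime m ->
  (forall x, `|x| < 1 -> power_series u x @ \oo --> U x) ->
  (forall x, `|x| < 1 -> power_series v x @ \oo --> V x) ->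
  (forall x, `|x| < 1 -> U x - V x = F (x ^+ m)) ->
  (forall n, ~~ (m %| n)%N -> u n = v n) /\
  (forall x, `|x| < 1 ->
    let u' := power_series (fun n => u (m * n)%N) x in
    let v' := power_series (fun n => v (m * n)%N) x in
    [/\ cvgn u', cvgn v' & limn u' - limn v' = F x]).
Proof.
move=> m_prime uU vV UVF; have m0 := prime_gt0 m_prime.
have [z z_prim] := prime_primitive_root R[i] m_prime.
have uv_cvg x : `|x| < 1 -> power_series (fun n => u n - v n) x @ \oo --> F (x ^+ m).
  by move=> x1; rewrite -UVF //; exact: cvg_power_seriesB (uU x x1) (vV x x1).
have uv0 := power_series_support_multiples z_prim uv_cvg.
split=> [n /uv0/eqP|x x1 u' v']; first by rewrite subr_eq0 => /eqP.
have u'_cvg : cvgn u' :=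
  is_cvg_power_series_section m0 (fun y lt1 => cvgP _ (uU y lt1)) x1.
have v'_cvg : cvgn v' :=
  is_cvg_power_series_section m0 (fun y lt1 => cvgP _ (vV y lt1)) x1.
split=> //; apply: cvgn_unique (cvg_power_seriesB u'_cvg v'_cvg) _.
exact: cvg_power_series_section m0 uv0 uv_cvg x x1.
Qed.

End ComplexPowerSeries.

Theorem theorem8 (R : realType) (a : int -> int) (b : nat -> int)
  (a_neg : forall n : int, n < 0 -> a n = 0)
  (a_def : forall q : Cplx R, `|q| < 1 ->
    (fun N : nat => \sum_(0 <= n < N) (a n%:Z)%:~R * q ^+ n) @ \oo -->
      qpochs [:: - q; - q ^+ 4] (q ^+ 5)
        * qpochs [:: q; q ^+ 9] (q ^+ 10) ^+ 3)
  (b_def : forall q : Cplx R, `|q| < 1 ->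
    (fun N : nat => \sum_(0 <= n < N) (b n)%:~R * q ^+ n) @ \oo -->
      qpochs [:: - q ^+ 2; - q ^+ 3] (q ^+ 5)
        * qpochs [:: q ^+ 3; q ^+ 7] (q ^+ 10) ^+ 3) :
  (forall q : Cplx R, `|q| < 1 ->
    let B := fun N : nat => \sum_(0 <= n < N) (b (5 * n)%N)%:~R * q ^+ n in
    let A := fun N : nat =>
      \sum_(1 <= n < N) (a (5 * n%:Z - 2))%:~R * q ^+ n in
    [/\ cvgn B, cvgn A
      & limn B - limn A = eulerf 1 q ^+ 4 / eulerf 2 q ^+ 4])
  /\ (forall n : nat,
    [/\ b (5 * n + 1)%N = a (5 * n%:Z - 1),
        b (5 * n + 2)%N = a (5 * n%:Z),
        b (5 * n + 3)%N = a (5 * n%:Z + 1)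
      & b (5 * n + 4)%N = a (5 * n%:Z + 2)]).
Proof.
pose a2 n : Cplx R := (a (n%:Z - 2))%:~R.
have a2_small n : (n < 2)%N -> a2 n = 0 by move=> n2; rewrite /a2 a_neg //; lia.
have a2_shift n : a2 (n + 2)%N = (a n%:Z)%:~R by rewrite /a2 PoszD addrK.
have a2_cvg x (x1 : `|x| < 1) := cvg_power_series_shift a2_small a2_shift (a_def x x1).
have [b_eq_a2 section_cvg] := power_series_prime_section
  (F := fun y => eulerf 1 y ^+ 4 / eulerf 2 y ^+ 4)
  (isT : prime 5) b_def a2_cvg (@decic_product_identityC R).
split=> [q q1 B A|n].
  have AE : A = power_series (fun n => a2 (5 * n)%N) q.
    apply/funext => -[|N]; rewrite /A /power_series; first by rewrite !big_geq.
    rewrite [RHS]big_ltn // a2_small // mul0r add0r.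
    by apply: eq_bigr => n _; rewrite /a2 PoszM.
  by rewrite AE; exact: section_cvg q q1.
have b_eq_a k : ~~ (5 %| k)%N -> b k = a (k%:Z - 2).
  by move=> /b_eq_a2/eqP; rewrite eqr_int => /eqP.
by split; rewrite b_eq_a; try lia; congr (a _); lia.
Qed.
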